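(* Let $h=\mathrm{diag}(-1,1,1,1)$ be the Minkowski metric on $\mathbb{R}^4$, let $c>0$ be the speed of light, $A_{max}>0$ a constant, and let $(M,g)$ be the spacetime of maximal acceleration whose associated Lorentzian metric is $\eta=h$. Consider a point particle of mass $m>0$ with timelike world line and squared proper acceleration $a^2(t)$, with $0\le a^2(t)<A_{max}^2$. Then, for an inertial observer instantaneously at rest with the particle at parameter value $t$ (so that the coordinate velocity satisfies $\vec{\mathbf v}(t)=0$), the energy $E(t)=c\,P^0(t)$ of the particle measured by the observer is $$E(t)=\frac{1}{\sqrt{1-\frac{a^2(t)}{A_{max}^2}}}\,mc^2.$$
   Context: Here $a^2(t)=h(x'',x'')$, where the world line $x$ is parameterized by the proper time of $h$. In the spacetime of maximal acceleration with $\eta=h$, the metric along such a curve is $g_{\mu\nu}=\left(1-\frac{a^2}{A_{max}^2}\right)h_{\mu\nu}$. The four-momentum is $P^\mu=m\,v^\mu$, where the four-velocity $v^\mu$ (with respect to the proper time of $g$) is $$v^\mu(t)=\frac{1}{\sqrt{1-\frac{a^2(t)}{A_{max}^2}}}\,\tilde v^\mu(t),$$ and $\tilde v^\mu$ is the usual relativistic four-velocity, which in an inertial coordinate system has components $$\tilde v^0=\frac{c}{\sqrt{1-\vec{\mathbf v}^2/c^2}},\qquad \vec{\tilde v}=\frac{\vec{\mathbf v}}{\sqrt{1-\vec{\mathbf v}^2/c^2}},$$ with $\vec{\mathbf v}$ the coordinate velocity of the particle. *)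

(* Defs.v *)
From mathcomp Require Import all_boot all_order all_algebra.
From mathcomp Require Import all_classical all_reals all_analysis.
Set Implicit Arguments.
Unset Strict Implicit.
Unset Printing Implicit Defensive.
Import Order.TTheory GRing.Theory Num.Theory.
Import numFieldNormedType.Exports.
Local Open Scope classical_set_scope.
Local Open Scope ring_scope.

(* Points and vectors of R^4 are row vectors (u^0, u^1, u^2, u^3), where
   u^0 = c * (coordinate time).  A symmetric bilinear form is given by its
   Gram matrix G. *)
Definition bilin_form (R : realType) (G : 'M[R]_4) (u w : 'rV[R]_4) : R :=
  (u *m G *m w^T) ord0 ord0.

Definition minkowski (R : realType) : 'M[R]_4 :=
  diag_mx (\row_(i < 4) if i == ord0 then -1 else 1).
Arguments minkowski {R}.

(* The derivative df/ds of f with respect to s, both being functions of an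
   auxiliary parameter. *)
Definition derive_wrt (R : realType) (V : normedModType R)
    (s : R -> R) (f : R -> V) (t : R) : V :=
  lim ((s u - s t)^-1 *: (f u - f t) @[u --> t^']).

(* Signed proper time elapsed between the parameter values t0 and t along the
   curve x, for the metric whose value at x(s) is G s:
     int_t0^t sqrt (- G(x', x')) / c ds. *)
Definition proper_time (R : realType) (c : R) (G : R -> 'M[R]_4)
    (x : R -> 'rV[R]_4) (t0 t : R) : R :=
  let rate s := Num.sqrt (- bilin_form (G s) (derive1 x s) (derive1 x s)) / c in
  if t0 <= t then \int[lebesgue_measure]_(s in `[t0, t]) rate s
  else - \int[lebesgue_measure]_(s in `[t, t0]) rate s.

(* Twice continuously differentiable, future-directed timelike curve defined
   on the open interval I and parameterized by the proper time of the
   Minkowski metric. *)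
Record world_line (R : realType) (c : R) (I : set R) (x : R -> 'rV[R]_4) :
    Prop := WorldLine {
  wl_open : open I;
  wl_interval : is_interval I;
  wl_derivable1 : forall t, I t -> derivable x t 1;
  wl_derivable2 : forall t, I t -> derivable (derive1 x) t 1;
  wl_continuous2 : forall t, I t -> {for t, continuous (derive1 (derive1 x))};
  wl_timelike : forall t, I t ->
    bilin_form minkowski (derive1 x t) (derive1 x t) < 0;
  wl_future : forall t, I t -> 0 < derive1 x t ord0 ord0;
  wl_proper : forall t0 t, I t0 -> I t ->
    proper_time c (fun=> minkowski) x t0 t = t - t0
}.

(* a^2(t) = h(x'', x''); the covariant derivative of the flat metric h is the
   ordinary one. *)
Definition sq_acceleration (R : realType) (x : R -> 'rV[R]_4) (t : R) : R :=
  bilin_form minkowski (derive1 (derive1 x) t) (derive1 (derive1 x) t).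

(* The metric of maximal acceleration depends on the second jet of the curve;
   this is its value along x. *)
Definition max_acc_metric (R : realType) (Amax : R) (x : R -> 'rV[R]_4)
    (t : R) : 'M[R]_4 :=
  (1 - sq_acceleration x t / Amax ^+ 2) *: minkowski.

(* dx/dtau for the proper time tau of the metric of maximal acceleration.  The
   origin of tau is immaterial and is put at the point considered. *)
Definition four_velocity (R : realType) (c Amax : R) (x : R -> 'rV[R]_4)
    (t : R) : 'rV[R]_4 :=
  derive_wrt (proper_time c (max_acc_metric Amax x) x t) x t.

Definition four_momentum (R : realType) (c Amax m : R) (x : R -> 'rV[R]_4)
    (t : R) : 'rV[R]_4 :=
  m *: four_velocity c Amax x t.

(* An inertial observer is given by its inertial coordinates
   p |-> p *m L + b, with L an orthochronous Lorentz transformation (acting on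
   rows); the components of a vector w in these coordinates are w *m L. *)
Definition orthochronous_lorentz (R : realType) (L : 'M[R]_4) : Prop :=
  L *m minkowski *m L^T = minkowski /\ 0 < L ord0 ord0.

Definition observed (R : realType) (L : 'M[R]_4) (b : 'rV[R]_4)
    (x : R -> 'rV[R]_4) (t : R) : 'rV[R]_4 :=
  x t *m L + b.

(* The derivative of the spatial coordinates with respect to the coordinate
   time y^0 / c. *)
Definition coordinate_velocity (R : realType) (c : R) (y : R -> 'rV[R]_4)
    (t : R) : 'rV[R]_3 :=
  derive_wrt (fun u => y u ord0 ord0 / c)
    (fun u => \row_(i < 3) y u ord0 (lift ord0 i)) t.

(* E = c P^0, with P^0 the time component in the coordinates of the observer. *)
Definition observed_energy (R : realType) (c Amax m : R) (L : 'M[R]_4)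
    (x : R -> 'rV[R]_4) (t : R) : R :=
  c * (four_momentum c Amax m x t *m L) ord0 ord0.

(* Main.v *)
(** By the fundamental theorem of calculus the [h]-proper time of [x] has rate
    [sqrt (- h(x', x')) / c], so parameterization by proper time forces
    [h(x', x') = - c^2]; the proper time of the metric of maximal acceleration
    then has rate [lambda = sqrt (1 - a^2 / Amax^2)], and the four-velocity is
    [x' / lambda].  In the rest frame the spatial components of [x'] vanish, so
    Lorentz invariance of [h(x', x')] makes its time component [c] up to sign;
    the sign is positive since orthochronous transformations preserve the
    future cone. *)
Require Import Defs.
From mathcomp Require Import all_boot all_order all_algebra.
From mathcomp Require Import all_classical all_reals all_analysis.
From mathcomp Require Import ring lra.
Import Order.TTheory GRing.Theory Num.Theory.
Import numFieldNormedType.Exports.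
Local Open Scope classical_set_scope.
Local Open Scope ring_scope.

(* The bare name denotes Minkowski's integral inequality of the library. *)
Local Notation minkowski := Defs.minkowski.

(** * Derivatives with respect to a function of the parameter *)

Lemma difference_quotient_cvg {R : realType} {V : normedModType R}
    {f : R -> V} {t : R} :
  derivable f t 1 -> (u - t)^-1 *: (f u - f t) @[u --> t^'] --> derive1 f t.
Proof.
rewrite derive1E => df.
have shiftt : (u - t) @[u --> t^'] --> (0 : R)^'.
  rewrite -(subrr t).
  apply: (@continuous_injective_withinNx _ _ (fun u : R => u - t)).
    by apply: cvgB; [exact: cvg_id|exact: cvg_cst].
  by move=> y /addIr.
have := cvg_comp _ _ shiftt df.
apply: cvg_trans; apply: near_eq_cvg; near=> u => /=.
by rewrite [(u - t) *: 1]mulr1 subrK.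
Unshelve. all: by end_near. Qed.

Lemma derive_wrtE {R : realType} {V : normedModType R} (s : R -> R)
    (f : R -> V) (t : R) :
  derivable s t 1 -> derivable f t 1 -> derive1 s t != 0 ->
  derive_wrt s f t = (derive1 s t)^-1 *: derive1 f t.
Proof.
move=> ds df s0; apply/cvg_lim; first exact: norm_hausdorff.
apply: cvg_trans (cvgZ (cvgV s0 (difference_quotient_cvg ds))
                       (difference_quotient_cvg df)).
apply: near_eq_cvg; near=> u.
(* Only [u - t] is cancelled; where [s u = s t] both sides are 0, as the inverse of 0 is 0. *)
rewrite /unstable.inv_fun/= [_ *: (s u - s t)]/(_ * _) scalerA invfM invrK.
rewrite mulrAC mulfV ?mul1r//.
by rewrite subr_eq0; near: u; exact: nbhs_dnbhs_neq.
Unshelve. all: by end_near. Qed.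

(** The shape of [proper_time], convertible to it, isolated so that the calculus below concerns an
    arbitrary integrand. *)
Definition signed_integral {R : realType} (f : R -> R) (t u : R) : R :=
  if t <= u then \int[lebesgue_measure]_(s in `[t, u]) f s
  else - \int[lebesgue_measure]_(s in `[u, t]) f s.

(** Moving the base point to the left of both [t] and [u] removes the case distinction, so that one
    primitive serves on both sides of [t]. *)
Lemma signed_integralE {R : realType} {f : R -> R} {a b t u : R} :
  {within `[a, b], continuous f} -> a < t < b -> a < u < b ->
  signed_integral f t u = \int[lebesgue_measure]_(s in `[a, u]) f s
                        - \int[lebesgue_measure]_(s in `[a, t]) f s.
Proof.
move=> cf.
have intf p : p <= b -> lebesgue_measure.-integrable `[a, p] (EFin \o f).
  move=> pb; apply: continuous_compact_integrable.
    exact: segment_compact.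
  apply: continuous_subspaceW cf.
  by apply: subset_itvl; rewrite bnd_simp.
have split_int p q : a < p -> p <= q -> q < b ->
    \int[lebesgue_measure]_(s in `[a, q]) f s
      - \int[lebesgue_measure]_(s in `[a, p]) f s
    = \int[lebesgue_measure]_(s in `[p, q]) f s.
  move=> ap pq qb.
  rewrite Rintegral_itvB ?bnd_simp//; last exact: ltW.
  - rewrite Rintegral_itv_obnd_cbnd//.
    apply: integrableS (intf q (ltW qb)) => //.
    by apply: subset_itvr; rewrite bnd_simp ltW.
  - exact/intf/ltW.
move=> /andP[at_ tb] /andP[au ub]; rewrite /signed_integral.
have [tu|/ltW ut] := leP t u; first by rewrite -split_int.
by rewrite -split_int// opprB.
Qed.

Lemma signed_integral_derive {R : realType} (f : R -> R) (t : R) :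
  (\forall s \near t, {for s, continuous f}) ->
  is_derive t 1 (signed_integral f t) (f t).
Proof.
move=> /nbhs_ballP[e /= e0 cf].
(* Half the radius keeps the closed interval inside the open ball where [f] is continuous, with [t]
   in its interior. *)
pose a := t - e / 2; pose b := t + e / 2.
have [at_ tb] : a < t /\ t < b by rewrite /a /b; split; lra.
have cfab : {within `[a, b], continuous f}.
  apply: continuous_in_subspaceT => s; rewrite inE/= in_itv/= => /andP[as_ sb].
  by apply: cf; rewrite /ball/= ltr_distlC; rewrite /a /b in as_ sb; lra.
have intf : lebesgue_measure.-integrable `[a, b] (EFin \o f).
  by apply: continuous_compact_integrable => //; exact: segment_compact.
have [dF Ft] := continuous_FTC1_closed tb intf at_ (cf t (ballxx t e0)).
set F := (fun x : R => _) in dF Ft.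
have dG : is_derive t 1 (fun u => F u - F t) (f t).
  have := is_deriveB (derivableP dF) (is_derive_cst (F t) t 1).
  by rewrite subr0 -derive1E Ft.
apply: near_eq_is_derive dG.
near=> u; rewrite (signed_integralE cfab) ?at_//.
by apply/andP; split; near: u; [exact: lt_nbhsr|exact: lt_nbhsl].
Unshelve. all: by end_near. Qed.

(** * The Minkowski form and proper time *)

Lemma bilin_minkowskiE {R : realType} (u w : 'rV[R]_4) :
  bilin_form minkowski u w = - (u ord0 ord0 * w ord0 ord0)
    + \sum_(i < 3) u ord0 (lift ord0 i) * w ord0 (lift ord0 i).
Proof.
rewrite /bilin_form /minkowski mul_mx_diag mxE big_ord_recl !mxE/= mulrN1 mulNr.
by congr (_ + _); apply: eq_bigr => i _; rewrite !mxE/= mulr1.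
Qed.

Lemma bilin_formZ {R : realType} (k : R) (G : 'M[R]_4) (u w : 'rV[R]_4) :
  bilin_form (k *: G) u w = k * bilin_form G u w.
Proof. by rewrite /bilin_form -scalemxAr -scalemxAl mxE. Qed.

Lemma bilin_minkowski_cvg {R : realType} {T : Type} {F : set_system T}
    {FF : Filter F} (X : T -> 'rV[R]_4) (l : 'rV[R]_4) :
  X s @[s --> F] --> l ->
  bilin_form minkowski (X s) (X s) @[s --> F] --> bilin_form minkowski l l.
Proof.
move=> Xl.
have Xi i : X s ord0 i @[s --> F] --> l ord0 i.
  apply: (cvg_comp X (fun M : 'rV[R]_4 => M ord0 i) Xl).
  exact: coord_continuous.
under eq_fun do rewrite bilin_minkowskiE.
rewrite bilin_minkowskiE; apply: cvgD; first by apply: cvgN; exact: cvgM.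
have sum3 := (big_ord_recl, big_ord0, addr0).
under eq_fun do rewrite !sum3; rewrite !sum3.
by apply: cvgD; [|apply: cvgD]; exact: cvgM.
Qed.

Lemma proper_time_derive {R : realType} (c : R) {G : R -> 'M[R]_4}
    {x : R -> 'rV[R]_4} {t : R} :
  (\forall s \near t,
    {for s, continuous (fun s => bilin_form (G s) (derive1 x s) (derive1 x s))}) ->
  is_derive t 1 (proper_time c G x t)
    (Num.sqrt (- bilin_form (G t) (derive1 x t) (derive1 x t)) / c).
Proof.
move=> cG; apply: (@signed_integral_derive _ (fun s =>
  Num.sqrt (- bilin_form (G s) (derive1 x s) (derive1 x s)) / c)).
apply: filterS cG => s cGs; apply: cvgM; last exact: cvg_cst.
by apply: (cvg_comp _ _ (cvgN cGs)); exact: sqrt_continuous.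
Qed.

(** * Speed and four-velocity of a world line *)

Section world_line.
Context {R : realType} {c : R} {I : set R} {x : R -> 'rV[R]_4}.
Hypotheses (hc : 0 < c) (hx : world_line c I x).

Lemma near_world_line {t} : I t -> \forall s \near t, I s.
Proof. by move=> It; apply: open_nbhs_nbhs; split => //; exact: wl_open hx. Qed.

Lemma speed_continuous {s} : I s ->
  {for s, continuous (fun s => bilin_form minkowski (derive1 x s) (derive1 x s))}.
Proof.
move=> Is; apply: bilin_minkowski_cvg.
exact/differentiable_continuous/derivable1_diffP/(wl_derivable2 hx).
Qed.

Lemma speed_sq {t} : I t ->
  bilin_form minkowski (derive1 x t) (derive1 x t) = - c ^+ 2.
Proof.
move=> It.
have d1 : is_derive t 1 (proper_time c (fun=> minkowski) x t)
    (Num.sqrt (- bilin_form minkowski (derive1 x t) (derive1 x t)) / c).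
  apply: (@proper_time_derive _ _ (fun=> minkowski)).
  by apply: filterS (near_world_line It) => s; exact: speed_continuous.
have d2 : is_derive t 1 (proper_time c (fun=> minkowski) x t) 1.
  have : is_derive t 1 (fun u : R => u - t) 1.
    by have := is_deriveB (is_derive_id t 1) (is_derive_cst t t 1); rewrite subr0.
  apply: near_eq_is_derive.
  apply: filterS (near_world_line It) => s Is.
  by rewrite (wl_proper hx It Is).
have : Num.sqrt (- bilin_form minkowski (derive1 x t) (derive1 x t)) / c = 1.
  by rewrite -(@derive_val _ _ _ _ _ _ _ d1) (@derive_val _ _ _ _ _ _ _ d2).
move=> /(congr1 ( *%R^~ c)); rewrite mul1r divfK ?gt_eqF// => sqrtc.
(* Timelikeness makes the radicand nonnegative, so squaring undoes the root. *)
by rewrite -sqrtc sqr_sqrtr ?opprK// oppr_ge0 ltW// (wl_timelike hx).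
Qed.

Lemma four_velocityE (Amax : R) {t : R} : I t ->
  0 < 1 - sq_acceleration x t / Amax ^+ 2 ->
  four_velocity c Amax x t =
  (Num.sqrt (1 - sq_acceleration x t / Amax ^+ 2))^-1 *: derive1 x t.
Proof.
move=> It k0.
have : is_derive t 1 (proper_time c (max_acc_metric Amax x) x t)
    (Num.sqrt (1 - sq_acceleration x t / Amax ^+ 2)).
  have : \forall s \near t, {for s, continuous (fun s =>
      bilin_form (max_acc_metric Amax x s) (derive1 x s) (derive1 x s))}.
    apply: filterS (near_world_line It) => s Is.
    rewrite (_ : (fun s => _) = (fun s => (1 - sq_acceleration x s / Amax ^+ 2)
        * bilin_form minkowski (derive1 x s) (derive1 x s))); last first.
      by apply/funext => s'; exact: bilin_formZ.
    apply: cvgM; last exact: speed_continuous.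
    apply: cvgB; first exact: cvg_cst.
    apply: cvgM; last exact: cvg_cst.
    by apply: bilin_minkowski_cvg; exact: (wl_continuous2 hx).
  move=> /(proper_time_derive c).
  (* The radicand is now [(1 - a^2 / Amax^2) * c^2]; its root contributes a factor [c] that cancels
     the division by [c]. *)
  rewrite /max_acc_metric bilin_formZ speed_sq// mulrN opprK.
  by rewrite sqrtrM ?ltW// sqrtr_sqr gtr0_norm// mulfK ?gt_eqF.
move=> [dtau tau'].
rewrite /four_velocity derive_wrtE// ?derive1E ?tau'//.
- exact: (wl_derivable1 hx).
- by rewrite gt_eqF// sqrtr_gt0.
Qed.

End world_line.

(** * Lorentz transformations and the future cone *)

Lemma minkowski_sqr {R : realType} : minkowski *m minkowski = 1%:M :> 'M[R]_4.
Proof.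
rewrite /minkowski mulmx_diag -diag_const_mx; congr diag_mx.
by apply/rowP => i; rewrite !mxE; case: ifP => _; rewrite ?mulrNN mulr1.
Qed.

Lemma lorentz_bilin_form {R : realType} (L : 'M[R]_4) (u w : 'rV[R]_4) :
  L *m minkowski *m L^T = minkowski ->
  bilin_form minkowski (u *m L) (w *m L) = bilin_form minkowski u w.
Proof.
move=> hL; rewrite /bilin_form trmx_mul -{2}hL.
by rewrite !mulmxA.
Qed.

(** As [minkowski] is its own inverse, the hypothesis says that [L^T *m minkowski] is a right
    inverse of [L *m minkowski], hence also a left inverse. This turns information on the rows of
    [L] into information on its columns. *)
Lemma lorentz_tr {R : realType} (L : 'M[R]_4) :
  L *m minkowski *m L^T = minkowski -> L^T *m minkowski *m L = minkowski.
Proof.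
move=> hL.
have /mulmx1C : (L *m minkowski) *m (L^T *m minkowski) = 1%:M.
  by rewrite mulmxA hL minkowski_sqr.
move=> /(congr1 (mulmx^~ minkowski)).
by rewrite mul1mx -!mulmxA minkowski_sqr mulmx1.
Qed.

Lemma bilin_form_row {R : realType} (G A : 'M[R]_4) (i : 'I_4) :
  bilin_form G (row i A) (row i A) = (A *m G *m A^T) i i.
Proof.
rewrite /bilin_form -row_mul mxE [RHS]mxE.
by apply: eq_bigr => j _; rewrite !mxE.
Qed.

(** Lagrange's identity: the difference of the two sides is a sum of three squares. *)
Lemma cauchy_schwarz3 {R : realDomainType} (u v : 'I_3 -> R) :
  (\sum_i u i * v i) ^+ 2 <= (\sum_i u i ^+ 2) * (\sum_i v i ^+ 2).
Proof.
rewrite !big_ord_recl !big_ord0 !addr0.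
move: (u _) (u _) (u _) (v _) (v _) (v _) => u0 u1 u2 v0 v1 v2.
rewrite -subr_ge0 [leRHS](_ : _ = (u0 * v1 - u1 * v0) ^+ 2
  + (u0 * v2 - u2 * v0) ^+ 2 + (u1 * v2 - u2 * v1) ^+ 2); last by ring.
by rewrite !addr_ge0 ?sqr_ge0.
Qed.

(** By Cauchy-Schwarz the spatial product is strictly smaller than [a * b] in absolute value, so it
    cannot outweigh it. *)
Lemma timelike_dot_gt0 {R : realDomainType} (a b : R) (u v : 'I_3 -> R) :
  0 < a -> 0 < b -> \sum_i u i ^+ 2 < a ^+ 2 -> \sum_i v i ^+ 2 < b ^+ 2 ->
  0 < a * b + \sum_i u i * v i.
Proof.
move=> a0 b0 ua vb.
have : (\sum_i u i * v i) ^+ 2 < (a * b) ^+ 2.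
  apply: le_lt_trans (cauchy_schwarz3 u v) _.
  by rewrite exprMn ltr_pM// sumr_ge0// => i _; exact: sqr_ge0.
have ab0 : 0 < a * b by exact: mulr_gt0.
rewrite -[X in X < _ -> _]real_normK ?num_real// ltr_pXn2r ?nnegrE ?(ltW ab0)//.
by rewrite ltr_norml -subr_gt0 opprK addrC => /andP[].
Qed.

(** The time component of [u *m L] is the Euclidean product of [u] with the first column of [L]. By
    [lorentz_tr] that column is timelike, and its time entry is positive, so [timelike_dot_gt0]
    applies. *)
Lemma orthochronous_future {R : realType} (L : 'M[R]_4) (u : 'rV[R]_4) :
  orthochronous_lorentz L -> bilin_form minkowski u u < 0 ->
  0 < u ord0 ord0 -> 0 < (u *m L) ord0 ord0.
Proof.
move=> [hL L0]; rewrite bilin_minkowskiE addrC subr_lt0 => u2 u0.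
have : bilin_form minkowski (row ord0 L^T) (row ord0 L^T) < 0.
  rewrite bilin_form_row trmxK lorentz_tr// /minkowski !mxE eqxx mulr1n.
  by rewrite ltrN10.
rewrite bilin_minkowskiE addrC subr_lt0 !mxE; under eq_bigr do rewrite !mxE; move=> L2.
by rewrite big_ord_recl; apply: timelike_dot_gt0.
Qed.

(** * Velocity in the coordinates of the observer *)

Lemma observed_coord_derive {R : realType} {x : R -> 'rV[R]_4} {t : R}
    (L : 'M[R]_4) (b : 'rV[R]_4) (j : 'I_4) : derivable x t 1 ->
  is_derive t 1 (fun u => observed L b x u ord0 j)
    ((derive1 x t *m L) ord0 j).
Proof.
move=> dx.
have dxk k : is_derive t 1 (fun u => x u ord0 k) (derive1 x t ord0 k).
  rewrite derive1E derive_mx// mxE; apply: derivableP.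
  exact: (derivable_mxP _ _ _).1 dx ord0 k.
have := is_deriveD (is_derive_sum (fun k => is_deriveZ (L k j) (dxk k)))
                   (is_derive_cst (b ord0 j) t 1).
rewrite addr0 mxE; congr is_derive.
  apply/funext => u; rewrite /observed !mxE /= fct_sumE; congr (_ + _).
  by apply: eq_bigr => k _; exact: mulrC.
by apply: eq_bigr => k _; exact: mulrC.
Qed.

Lemma coordinate_velocityE {R : realType} {c : R} {x : R -> 'rV[R]_4} {t : R}
    (L : 'M[R]_4) (b : 'rV[R]_4) :
  c != 0 -> derivable x t 1 -> (derive1 x t *m L) ord0 ord0 != 0 ->
  coordinate_velocity c (observed L b x) t
  = (c / (derive1 x t *m L) ord0 ord0)
    *: \row_(i < 3) (derive1 x t *m L) ord0 (lift ord0 i).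
Proof.
move=> c0 dx w0.
have [dy0 y0'] : is_derive t 1 (fun u => observed L b x u ord0 ord0 / c)
    ((derive1 x t *m L) ord0 ord0 / c).
  have := is_deriveZ c^-1 (observed_coord_derive L b ord0 dx).
  rewrite [_ *: _]mulrC; congr is_derive.
  by apply/funext => u; exact: mulrC.
have dy : derivable (fun u => \row_(i < 3) observed L b x u ord0 (lift ord0 i)) t 1.
  apply/derivable_mxP => i j; under eq_fun do rewrite mxE.
  by case: (observed_coord_derive L b (lift ord0 j) dx).
have y' : derive1 (fun u => \row_(i < 3) observed L b x u ord0 (lift ord0 i)) t
    = \row_(i < 3) (derive1 x t *m L) ord0 (lift ord0 i).
  rewrite derive1E (derive_mx dy); apply/rowP => i; rewrite [LHS]mxE [RHS]mxE.
  under eq_fun do rewrite mxE.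
  by case: (observed_coord_derive L b (lift ord0 i) dx).
rewrite -derive1E in y0'.
rewrite /coordinate_velocity derive_wrtE// y0' ?mulf_neq0 ?invr_eq0//.
by rewrite y' invf_div.
Qed.

Theorem mainTheorem4 (R : realType) (c Amax m : R)
  (hc : 0 < c) (hA : 0 < Amax) (hm : 0 < m)
  (I : set R) (x : R -> 'rV[R]_4) (hx : world_line c I x)
  (ha : forall s, I s -> 0 <= sq_acceleration x s < Amax ^+ 2)
  (L : 'M[R]_4) (b : 'rV[R]_4) (hL : orthochronous_lorentz L)
  (t : R) (ht : I t)
  (hrest : coordinate_velocity c (observed L b x) t = 0) :
  observed_energy c Amax m L x t
  = 1 / Num.sqrt (1 - sq_acceleration x t / Amax ^+ 2) * (m * c ^+ 2).
Proof.
have k0 : 0 < 1 - sq_acceleration x t / Amax ^+ 2.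
  have /andP[_ aA] := ha t ht.
  by rewrite subr_gt0 ltr_pdivrMr ?mul1r// exprn_gt0.
have w0 : 0 < (derive1 x t *m L) ord0 ord0.
  exact: orthochronous_future (wl_timelike hx ht) (wl_future hx ht).
have wi i : (derive1 x t *m L) ord0 (lift ord0 i) = 0.
  have := hrest; rewrite coordinate_velocityE ?gt_eqF//; last first.
    exact: wl_derivable1 hx t ht.
  (* Generalizing the product keeps [mxE] from expanding it; the factor [c / w^0] is nonzero, so the
     spatial component vanishes. *)
  move: (derive1 x t *m L) w0 => w w0 /rowP/(_ i)/eqP; rewrite !mxE mulf_eq0 mulf_eq0 invr_eq0.
  by rewrite (gt_eqF hc) (gt_eqF w0)/= => /eqP.
have wc : (derive1 x t *m L) ord0 ord0 = c.
  (* Invariance reduces to [(w^0)^2 = c^2] for the time component [w^0], and both [w^0] and [c] are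
     positive. *)
  have := lorentz_bilin_form L (derive1 x t) (derive1 x t) hL.1.
  rewrite (speed_sq hc hx ht) bilin_minkowskiE big1 => [|i _]; last first.
    by rewrite wi mulr0.
  rewrite addr0 -expr2 => /oppr_inj/eqP.
  by rewrite eqrXn2// ?ltW// => /eqP.
rewrite /observed_energy /four_momentum (four_velocityE hc hx Amax ht k0).
by rewrite -!scalemxAl 2!mxE wc; ring.
Qed.
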